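(* Let $M$ be a linear hypersurface in $\mathbb{R}^{n+1}$ and $\mathscr{L}$ be a (continuous) line bundle over $M$. Then $\operatorname{int}(\Delta_* \mathscr{L}) \neq \varnothing$ if and only if $\mathscr{L}$ is not tangent to $M$.
   Context: A linear hypersurface in $\mathbb{R}^{n+1}$ is a connected, nonempty, (relatively) open subset of an affine hyperplane. A line bundle over a subset $X\subseteq\mathbb{R}^{n+1}$ means the embedded bundle $\mathscr{L}=\{(p,u)\in X\times\mathbb{R}^{n+1}: u\in\varphi(p)\}$ defined by a continuous map $\varphi:X\to\mathbb{P}^{n}=\operatorname{Gr}_1(n+1)$ into the space of lines through $0$ in $\mathbb{R}^{n+1}$. $\mathscr{L}$ is tangent to $M$ iff $\varphi(p)\subseteq T_pM$ for all $p\in M$. The codiagonal map is $\Delta_*(x,y)=x+y$, so $\Delta_*\mathscr{L}=\bigcup_{p\in M}(p+\varphi(p))\subseteq\mathbb{R}^{n+1}$. $\operatorname{int}$ denotes interior in $\mathbb{R}^{n+1}$. *)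

(* Defs.v *)
From HB Require Import structures.
From mathcomp Require Import all_boot all_order all_algebra.
From mathcomp Require Import all_classical all_reals all_analysis.

Set Implicit Arguments.
Unset Strict Implicit.
Unset Printing Implicit Defensive.

Import Order.TTheory GRing.Theory Num.Theory.
Import numFieldNormedType.Exports.

Local Open Scope classical_set_scope.
Local Open Scope ring_scope.

(* The projective space P^n = Gr_1(n+1) of lines through 0 in R^(n+1). *)
Record projective (R : realType) (n : nat) := Projective {
  line_of :> {vspace 'rV[R]_n.+1};
  line_ofP : \dim line_of == 1%N }.

HB.instance Definition _ (R : realType) (n : nat) :=
  [isSub for @line_of R n].
HB.instance Definition _ (R : realType) (n : nat) :=
  [Choice of projective R n by <:].

Section projective_topology.
Context {R : realType} {n : nat}.
Implicit Types U : set (projective R n).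

(* The quotient topology along v |-> <[v]> from R^(n+1) minus 0. The set below
   is the preimage of U; it never contains 0, since \dim <[0]> = 0, and as
   R^(n+1) minus 0 is open, being open there or in R^(n+1) is the same. *)
Definition projective_open U :=
  open [set v : 'rV[R]_n.+1 |
        exists2 l : projective R n, U l & <[v]>%VS = l].

Let opT : projective_open setT.
Proof.
rewrite /projective_open.
suff -> : [set v : 'rV[R]_n.+1 |
    exists2 l : projective R n, [set: projective R n] l & <[v]>%VS = l]
    = ~` [set 0].
  apply: closed_openC; apply: accessible_closed_set1.
  exact/hausdorff_accessible/norm_hausdorff.
apply/seteqP; split => v /=.
  move=> [l _ vl] v0; have := line_ofP l.
  by rewrite -vl v0 dim_vline eqxx.
move=> /eqP v0.
have dv : \dim <[v]>%VS == 1%N by rewrite dim_vline v0.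
by exists (Projective dv).
Qed.

Let opI : setI_closed projective_open.
Proof.
move=> A B oA oB; rewrite /projective_open.
have := openI oA oB; congr (open _).
apply/seteqP; split => v /=.
  by move=> [[l Al vl] [m Bm vm]]; exists l => //; split=> //;
    rewrite (_ : l = m)//; apply: val_inj; rewrite /= -vl -vm.
by move=> [l [Al Bl] vl]; split; exists l.
Qed.

Let op_bigU (I : Type) (f : I -> set (projective R n)) :
  (forall i, projective_open (f i)) -> projective_open (\bigcup_i f i).
Proof.
move=> opf; rewrite /projective_open.
have := bigcup_open (fun i (_ : [set: I] i) => opf i); congr (open _).
apply/seteqP; split => v /=.
  by move=> [i _ [l fl vl]]; exists l => //; exists i.
by move=> [l [i _ fl] vl]; exists i => //; exists l.
Qed.

HB.instance Definition _ :=
  isOpenTopological.Build (projective R n) opT opI op_bigU.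

End projective_topology.

Definition affine_hyperplane {R : realType} {n : nat}
    (A : set 'rV[R]_n.+1) : Prop :=
  exists (a : 'rV[R]_n.+1) (H : {vspace 'rV[R]_n.+1}),
    \dim H = n /\ A = [set x | x - a \in H].

Definition linear_hypersurface {R : realType} {n : nat}
    (M : set 'rV[R]_n.+1) : Prop :=
  [/\ connected M, M !=set0 &
      exists A U : set 'rV[R]_n.+1,
        [/\ affine_hyperplane A, open U & M = A `&` U]].

(* T_p M, as the set of velocities at time 0 of curves through p that stay
   in M and are differentiable at 0. *)
Definition tangent_space {R : realType} {n : nat}
    (M : set 'rV[R]_n.+1) (p : 'rV[R]_n.+1) : set 'rV[R]_n.+1 :=
  [set v | exists gamma : R -> 'rV[R]_n.+1,
     [/\ gamma 0 = p, \forall t \near 0, M (gamma t)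
       & is_derive (0 : R) (1 : R) gamma v]].

(* Line bundles over X are given by maps phi defined on all of R^(n+1), of
   which only the restriction to X is used. *)
Definition line_bundle {R : realType} {n : nat} (X : set 'rV[R]_n.+1)
    (phi : 'rV[R]_n.+1 -> projective R n) :
    set ('rV[R]_n.+1 * 'rV[R]_n.+1) :=
  [set pu | X pu.1 /\ pu.2 \in (phi pu.1 : {vspace 'rV[R]_n.+1})].

Definition line_bundle_tangent {R : realType} {n : nat} (M : set 'rV[R]_n.+1)
    (phi : 'rV[R]_n.+1 -> projective R n) : Prop :=
  forall p, M p ->
    [set u | u \in (phi p : {vspace 'rV[R]_n.+1})] `<=` tangent_space M p.

Definition codiagonal {R : realType} {n : nat}
    (xy : 'rV[R]_n.+1 * 'rV[R]_n.+1) : 'rV[R]_n.+1 := xy.1 + xy.2.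

(* Main.v *)
Require Import Defs.
From HB Require Import structures.
From mathcomp Require Import all_boot all_order all_algebra.
From mathcomp Require Import all_classical all_reals all_analysis.
From mathcomp Require Import zify ring lra.

(** Let [lam] be a linear form whose kernel directs the hyperplane containing
    [M].  The tangent spaces of [M] are all equal to this kernel
    ([tangent_space_hyperplane]).  If the bundle is tangent, every line through
    a point of [M] therefore stays in the hyperplane, which has empty interior
    ([kernel_interior]).

    Otherwise some line [phi p0] is transverse to the hyperplane, and [p0]
    itself is an interior point of the union of the lines
    ([transverse_interior]).  Near [p0] the line [phi p] has a unique point
    [s p] with [lam (s p) = 1], which depends continuously on [p]
    ([unit_point_nbhs]).  A point [q] lies on the line through [p] if
    [q = p + lam (q - p0) *: s p], that is, if [p] is a fixed point of
    [p |-> q - lam (q - p0) *: s p].  For [q] close to [p0] this continuous map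
    sends a neighborhood of [p0] in the hyperplane into a small neighborhood of
    [p0] in the hyperplane, so that Brouwer's theorem provides the fixed point
    ([local_fixed_point]).

    Brouwer's theorem is proved on the standard simplex ([brouwer_simplex]).
    Instead of triangulating the simplex, the combinatorial step uses on a fine
    grid the orders given by the barycentric coordinates.  A set of grid points
    dominates if each grid point lies below all of that set in one of the
    orders.  A parity argument on dominating sets, which behave like the
    simplices of a triangulation ([dominant_extensions_even],
    [facets_missing_color_even]), produces one that carries all the relevant
    colors ([exists_colorful_dominant]); such a set has small diameter
    ([dominant_grid_close]), and its limits are fixed points. *)

Set Implicit Arguments.
Unset Strict Implicit.
Unset Printing Implicit Defensive.

Import Order.TTheory GRing.Theory Num.Theory.
Import numFieldNormedType.Exports.

(** * Linear orders and dominant sets *)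

Section Dominance.
Import mathcomp.boot.fintype mathcomp.boot.finset.
Variables (V I : finType) (r : I -> V -> nat).
Hypothesis r_inj : forall i, injective (r i).
Implicit Types (A D : {set V}) (x y z : V) (i j k l : I).

(** The family [r] is a collection of linear orders on [V], given by ranks.
    Choosing an index of domination for each element of [A] is injective,
    so a dominant set has at most #|I| elements; the sets with exactly #|I|
    elements play the part of the simplices of a triangulation, those with
    one element less the part of their facets. *)
Definition dominant A :=
  [forall y, exists i, [forall x in A, r i y <= r i x]].

Lemma dominantP A :
  reflect (forall y, exists i, forall x, x \in A -> r i y <= r i x)
          (dominant A).
Proof.
apply: (iffP forallP) => dA y; have := dA y.
  by move=> /existsP[i /forall_inP rA]; exists i.
by move=> [i rA]; apply/existsP; exists i; apply/forall_inP.
Qed.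

Lemma dominantW A D : D \subset A -> dominant A -> dominant D.
Proof.
move=> /subsetP DA /dominantP dA; apply/dominantP => y.
by have [i ri] := dA y; exists i => x /DA; apply: ri.
Qed.

(** When [D] is dominant, these are the points that it dominates through the
    order [k] only.  If a new point becomes the minimum for [k] of an enlarged
    dominant set, it must still lie above all of them in that order. *)
Definition beyond D k : {set V} :=
  [set y | [forall (l | l != k), exists x in D, r l x < r l y]].

Lemma beyondP D k y :
  reflect (forall l, l != k -> exists2 x, x \in D & r l x < r l y)
          (y \in beyond D k).
Proof.
rewrite inE; apply: (iffP forall_inP) => H l /H.
  by move=> /exists_inP.
by move=> ?; apply/exists_inP.
Qed.

Lemma beyond_last D k : beyond D k != set0 ->
  exists2 y, y \in beyond D k & forall z, z \in beyond D k -> r k z <= r k y.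
Proof.
move=> /set0Pn[y0 y0D].
by case: (arg_maxnP (fun y => r k y) y0D) => y yD ymax; exists y.
Qed.

Lemma dominant_last D k y : dominant D -> y \in beyond D k ->
  (forall z, z \in beyond D k -> r k z <= r k y) -> dominant (y |: D).
Proof.
move=> /dominantP dD /beyondP yD ymax; apply/dominantP => z.
have [zD|] := boolP (z \in beyond D k).
  exists k => x; rewrite !inE => /predU1P[->|xD]; first exact: ymax.
  have [l zl] := dD z; have [lk|lk] := eqVneq l k.
    by rewrite -lk; apply: zl.
  move/beyondP: zD => /(_ l lk)[x' x'D].
  by rewrite ltnNge zl.
rewrite inE negb_forall_in => /exists_inP[l lk].
rewrite negb_exists_in => /forall_inP zl; exists l => x.
have {}zl x' : x' \in D -> r l z <= r l x' by move/zl; rewrite -leqNgt.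
rewrite !inE => /predU1P[->|]; last exact: zl.
have [x' x'D /ltnW] := yD l lk; exact: leq_trans (zl _ x'D).
Qed.

(** An inner facet lies in exactly two simplices.  Sending an order [l] to the
    minimum [m l] of [D] maps [I] onto [D], which has one element less, so
    there is exactly one pair [i], [j] with [m i = m j].  When [D] is extended
    by [y], the minima must become a bijection; hence [y] takes over as minimum
    for a single order [k] in that pair, and the other orders force [y] to be
    the last point of [beyond D k] for [k]. *)
Lemma dominant_extensions_even D : D != set0 -> #|D|.+1 = #|I| -> dominant D ->
  (forall k, beyond D k != set0) ->
  ~~ odd #|[set y | y \notin D & dominant (y |: D)]|.
Proof.
move=> D0 cD dD bD; have dDP := elimT (dominantP _) dD.
have [x0 x0D] := set0Pn _ D0.
pose m l := [arg min_(x < x0 in D) r l x].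
have mD l : m l \in D by rewrite /m; case: arg_minnP.
have m_min l x : x \in D -> r l (m l) <= r l x.
  by rewrite /m; case: arg_minnP => // y _; apply.
have m_eq l x : x \in D -> (forall y, y \in D -> r l x <= r l y) -> m l = x.
  move=> xD xmin; apply: (@r_inj l); apply/eqP.
  by rewrite eqn_leq m_min//= xmin.
have onto_inj k : (forall x, x \in D -> exists2 l, l != k & m l = x) ->
    {in [set~ k] &, injective m}.
  move=> onto; apply/imset_injP.
  have -> : m @: [set~ k] = D.
    apply/setP => x; apply/imsetP/idP => [[l _ ->]//|/onto[l lk <-]].
    by exists l; rewrite ?inE.
  by rewrite cardsC1; lia.
have [i [j [ij mij]]] : exists i j, i != j /\ m i = m j.
  have /injectivePn[i [j ji mij]] : ~~ injectiveb m.
    apply/negP => /injectiveP minj.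
    have : #|m @: setT| <= #|D|.
      by apply: subset_leq_card; apply/subsetP => _ /imsetP[l _ ->].
    by rewrite card_imset// cardsT; lia.
  by exists i, j; rewrite eq_sym in ji *.
have onto k : k \in [set i; j] ->
    forall x, x \in D -> exists2 l, l != k & m l = x.
  move=> kij x xD; have [l xl] := dDP x.
  have ml := m_eq _ _ xD xl; have [lk|lk] := eqVneq l k; last by exists l.
  move: kij; rewrite !inE => /orP[] /eqP kE; rewrite {}kE in lk *.
    by exists j; rewrite 1?eq_sym// -mij -lk.
  by exists i => //; rewrite mij -lk.
have bnD k y : k \in [set i; j] -> y \in beyond D k -> y \notin D.
  move=> kij /beyondP yb; apply/negP => yD.
  have [l lk ml] := onto k kij y yD; have [x xD] := yb l lk.
  by rewrite ltnNge -ml m_min.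
have bI y : y \in beyond D i -> y \in beyond D j -> False.
  move=> /beyondP yi /beyondP yj.
  have [l yl] := dDP y.
  have [x xD] : exists2 x, x \in D & r l x < r l y.
    by have [->|/yi//] := eqVneq l i; apply: yj.
  by rewrite ltnNge yl.
have [yi yib yimax] := beyond_last (bD i).
have [yj yjb yjmax] := beyond_last (bD j).
suff -> : [set y | y \notin D & dominant (y |: D)] = [set yi; yj].
  rewrite cards2; case: eqP => // yij; exfalso.
  by apply: (bI yi) => //; rewrite yij.
apply/setP => y; rewrite !inE; apply/andP/orP; last first.
  move=> [] /eqP ->; split.
  - by apply: (bnD i) => //; rewrite !inE eqxx.
  - exact: dominant_last yib yimax.
  - by apply: (bnD j) => //; rewrite !inE eqxx orbT.
  - exact: dominant_last yjb yjmax.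
move=> [ynD /dominantP dyD].
have [k yk] := dyD y.
have {}yk x : x \in D -> r k y < r k x.
  move=> xD; rewrite ltn_neqAle yk ?inE ?xD ?orbT// andbT.
  by apply/eqP => /r_inj yx; rewrite yx xD in ynD.
have ontok x : x \in D ->
    exists l, [/\ l != k, m l = x & r l x <= r l y].
  move=> xD; have [l xl] := dyD x.
  have xl' : forall x', x' \in D -> r l x <= r l x'.
    by move=> x' x'D; apply: xl; rewrite !inE x'D orbT.
  exists l; split; [|exact: m_eq|by apply: xl; rewrite setU11].
  apply/eqP => lk; have := xl y (setU11 _ _).
  by rewrite lk leqNgt yk.
have injk : {in [set~ k] &, injective m}.
  by apply: onto_inj => x /ontok[l [lk ml _]]; exists l.
have kij : k \in [set i; j].
  apply/negPn/negP; rewrite !inE negb_or => /andP[ki kj].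
  have := injk i j; rewrite !inE ![_ == k]eq_sym => /(_ ki kj mij) /eqP.
  by rewrite (negPf ij).
have yb : y \in beyond D k.
  apply/beyondP => l lk; exists (m l) => //.
  have [l' [l'k ml' yl']] := ontok _ (mD l).
  rewrite (injk l' l) ?inE// in yl'.
  rewrite ltn_neqAle yl' andbT; apply/eqP => /r_inj mly.
  by rewrite -mly mD in ynD.
have ymax z : z \in beyond D k -> r k z <= r k y.
  move=> /beyondP zb; have [l zl] := dyD z.
  have [lk|lk] := eqVneq l k.
    by rewrite -lk; apply: zl; rewrite setU11.
  have [x xD] := zb l lk.
  by rewrite ltnNge zl ?inE ?xD ?orbT.
move: kij; rewrite !inE => /orP[] /eqP kE; rewrite {}kE in yb ymax *;
  [left|right].
  by apply/eqP/(@r_inj i)/eqP; rewrite eqn_leq yimax//= ymax.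
by apply/eqP/(@r_inj j)/eqP; rewrite eqn_leq yjmax//= ymax.
Qed.

End Dominance.

Section Coloring.
Import mathcomp.boot.fintype mathcomp.boot.finset.

(** If some facet [A :\ x] has all the colors but [i0], then [c x] occurs
    exactly twice in [A], because [c x = i0] would complete the colors of [A];
    removing either occurrence leaves the same colors, and no other removal
    does. *)
Lemma facets_missing_color_even (V I : finType) (c : V -> I) (i0 : I)
    (A : {set V}) :
  c @: A != setT ->
  ~~ odd #|[set x in A | (#|A :\ x|.+1 == #|I|) &&
                         (c @: (A :\ x) == [set~ i0])]|.
Proof.
move=> cA; set S := finset _.
have [->|[x]] := set_0Vmem S; first by rewrite cards0.
rewrite inE => /and3P[xA /eqP cardA /eqP cx].
have cinj : {in A :\ x &, injective c}.
  by apply/imset_injP; rewrite cx cardsC1; lia.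
have cx0 : c x != i0.
  apply: contraNneq cA => cx0; apply/eqP/setP => i; rewrite inE.
  have [->|ii0] := eqVneq i i0; first by rewrite -cx0 imset_f.
  have : i \in c @: (A :\ x) by rewrite cx !inE.
  by move=> /imsetP[y]; rewrite !inE => /andP[_ yA] ->; rewrite imset_f.
have /imsetP[x' x'A cxx'] : c x \in c @: (A :\ x) by rewrite cx !inE.
have := x'A; rewrite !inE => /andP[x'x x'inA].
suff -> : S = [set x; x'] by rewrite cards2 eq_sym x'x.
apply/setP => z; rewrite !inE; apply/and3P/orP; last first.
  move=> [] /eqP ->; split=> //; [exact/eqP|exact/eqP| |].
    by have := cardsD1 x A; have := cardsD1 x' A; rewrite xA x'inA; lia.
  apply/eqP; rewrite -cx; apply/setP => i; apply/imsetP/imsetP => -[y];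
    rewrite !inE => /andP[yx yA] ->.
    have [->|yx'] := eqVneq y x; first by exists x'; rewrite ?inE ?x'x.
    by exists y; rewrite ?inE ?yx'.
  have [->|yx'] := eqVneq y x'; first by exists x; rewrite ?inE 1?eq_sym ?x'x.
  by exists y; rewrite ?inE ?yx'.
move=> [zA _ /eqP cz]; apply/orP; apply: contraT.
rewrite negb_or => /andP[zx zx'].
have cz0 : c z \in [set~ i0] by rewrite -cx imset_f// !inE zx.
move: cz0; rewrite -cz => /imsetP[w]; rewrite !inE => /andP[wz wA] czw.
have [wx|wx] := eqVneq w x.
  have := cinj z x'; rewrite !inE zx zA x'x x'inA => /(_ isT isT).
  by rewrite czw wx cxx' => /(_ erefl) /eqP; rewrite (negPf zx').
have := cinj z w; rewrite !inE zx zA wx wA => /(_ isT isT czw)/eqP.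
by rewrite eq_sym (negPf wz).
Qed.

End Coloring.

Section Colorful.
Import mathcomp.boot.fintype mathcomp.boot.finset.
Variables (T I : finType) (a : I -> T -> nat) (col : T -> I) (t0 : T).

Let height := (\max_(i : I) \max_(x : T) a i x).+1 * #|T|.

(** Each index [j] is added to [T] as an ideal point of color [j], smaller than
    all of [T] for the order [j] and larger than all of [T] for the others.  A
    set [A] of points, ideal or not, then encodes the pair of its ordinary part
    and of the set [C] of the indices not in [A]: domination by [A] amounts to
    domination of [T] by the ordinary part, using the orders in [C] only.
    Equal values of [a i] are ordered by the enumeration of [T]. *)
Definition ext_rank (i : I) (z : T + I) : nat :=
  match z with
  | inl x => (a i x * #|T| + enum_rank x).+1
  | inr j => if j == i then 0 else (height + enum_rank j).+1
  end.

Definition ext_col (z : T + I) : I :=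
  match z with inl x => col x | inr i => i end.

Lemma ext_rank_lt i x : a i x * #|T| + enum_rank x < height.
Proof.
rewrite /height; have xT := ltn_ord (enum_rank x).
set b := \max_(i : I) _.
suff ab : a i x <= b.
  apply: (@leq_trans ((a i x).+1 * #|T|)); last first.
    by rewrite leq_mul2r ltnS ab orbT.
  by rewrite mulSn addnC -addSn leq_add2r.
by apply: leq_trans (leq_bigmax i); apply: (leq_bigmax x).
Qed.

Lemma ext_rank_inj i : injective (ext_rank i).
Proof.
move=> [x|j] [y|k] /=; do ?case: eqP => ?; subst=> //.
- move=> /succn_inj /(congr1 (modn^~ #|T|)).
  rewrite !modnMDl !modn_small ?ltn_ord//.
  by move=> /ord_inj/enum_rank_inj ->.
- by move=> /succn_inj E; have := ext_rank_lt i x; rewrite E ltnNge leq_addr.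
- by move=> /succn_inj E; have := ext_rank_lt i y; rewrite -E ltnNge leq_addr.
- by move=> /succn_inj /addnI /ord_inj/enum_rank_inj ->.
Qed.

Lemma ext_rank_le i x y : ext_rank i (inl x) <= ext_rank i (inl y) ->
  a i x <= a i y.
Proof.
move=> /= xy; rewrite leqNgt; apply/negP => yx; move: xy; apply/negP.
rewrite -ltnNge ltnS (@leq_trans ((a i y).+1 * #|T|))//.
  by rewrite mulSn addnC -addSn leq_add2r.
by rewrite (leq_trans _ (leq_addr _ _))// leq_mul2r yx orbT.
Qed.

Let dom := dominant ext_rank.

(** The cardinality makes [ext_col] injective on a door. *)
Definition door i0 (D : {set T + I}) :=
  (#|D|.+1 == #|I|) && (ext_col @: D == [set~ i0]).

(** The door made of all the ideal points except [i0] only needs the greatest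
    point of [T] for the order [i0]: it is the unique door on the boundary. *)
Lemma outer_door_one_extension i0 :
  #|[set y | y \notin inr @: [set~ i0] & dom (y |: inr @: [set~ i0])]| = 1.
Proof.
set D := inr @: _.
have [x _ xmax] : {x | true &
    forall y, ext_rank i0 (inl y) <= ext_rank i0 (inl x)}.
  case: (@arg_maxnP _ t0 xpredT (fun x => ext_rank i0 (inl x))) => // x _ h.
  by exists x => // y; apply: h.
have domx y : (forall z, ext_rank i0 (inl z) <= ext_rank i0 (inl y)) ->
    dom (inl y |: D).
  move=> ymax; apply/dominantP => -[z|j]; last first.
    by exists j => w _ /=; rewrite eqxx.
  exists i0 => w; rewrite in_setU1 => /predU1P[->//|].
  move=> /imsetP[k]; rewrite !inE => ki0 -> /=.
  rewrite (negPf ki0) ltnS.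
  exact: leq_trans (ltnW (ext_rank_lt _ _)) (leq_addr _ _).
suff -> : [set y | y \notin D & dom (y |: D)] = [set inl x] by rewrite cards1.
apply/setP => y; rewrite [LHS]inE inE; apply/andP/eqP; last first.
  by move=> ->; split; [apply/imsetP => -[]|apply: domx].
have inD j : j != i0 -> inr j \in D.
  by move=> ji0; rewrite imset_f// !inE.
have only_i0 k z w :
    (forall u, u \in w |: D -> ext_rank k (inl z) <= ext_rank k u) -> k = i0.
  move=> zk; apply/eqP; apply: contraT => /inD kD.
  by have := zk (inr k); rewrite /= eqxx in_setU1 kD orbT => /(_ isT).
case: y => [y|j] [ynD /dominantP dy].
  have [k xk] := dy (inl x).
  have k0 := only_i0 k x _ xk.
  have := xk (inl y) (setU11 _ _); rewrite k0 => xy.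
  by apply/eqP; rewrite -(inj_eq (@ext_rank_inj i0)) eqn_leq xmax xy.
have [k xk] := dy (inl t0).
have kD : inr k \in inr j |: D.
  have [->|/inD kD] := eqVneq k i0; last by rewrite inE kD orbT.
  have -> : i0 = j; last by rewrite setU11.
  by apply/eqP; apply: contraT; rewrite eq_sym => /inD; rewrite (negPf ynD).
by have := xk _ kD; rewrite /= eqxx.
Qed.

(** A door other than the outer one has an ordinary point [x], which puts the
    ideal point [k] beyond it for every [k]. *)
Lemma inner_door_even_extensions i0 D : door i0 D -> D != inr @: [set~ i0] ->
  ~~ odd #|[set y | y \notin D & dom (y |: D)]|.
Proof.
move=> /andP[/eqP cD /eqP colD] Dout.
have [x xD] : exists x, inl x \in D.
  apply/existsP; apply: contraR Dout; rewrite negb_exists => /forallP nD.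
  rewrite eqEsubset; apply/andP; split; apply/subsetP => z.
    case: z => [z|z zD]; first by rewrite (negPf (nD z)).
    by apply: imset_f; rewrite -colD; apply/imsetP; exists (inr z).
  move=> /imsetP[k]; rewrite -colD => /imsetP[[w|w] wD ->] ->//.
  by rewrite (negPf (nD w)) in wD.
have D0 : D != set0 by apply/set0Pn; exists (inl x).
have [dD|ndD] := boolP (dom D); last first.
  rewrite (_ : finset _ = set0) ?cards0//; apply/setP => y; rewrite !inE.
  apply/negP => /andP[_ dy]; move/negP: ndD; apply.
  exact: dominantW (subsetUr _ _) dy.
apply: dominant_extensions_even => //; first exact: ext_rank_inj.
move=> k; apply/set0Pn; exists (inr k); apply/beyondP => l lk.
exists (inl x) => //=; rewrite eq_sym (negPf lk).
by rewrite ltnS (leq_trans (ext_rank_lt _ _)) ?leq_addr.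
Qed.

(** Double counting of the pairs formed by a door and a dominant set obtained by
    adding one point to it: doors contribute an even number of pairs, except
    for the outer one, so some dominant set contains an odd number of doors;
    its colors cannot be missing any index. *)
Lemma exists_rainbow_dominant :
  exists2 A : {set T + I}, dom A & ext_col @: A = setT.
Proof.
pose i0 := col t0.
pose rooms (A : {set T + I}) := [set x in A | door i0 (A :\ x)].
pose ends (D : {set T + I}) := [set y | y \notin D & dom (y |: D)].
have flip : \sum_(A | dom A) #|rooms A| = \sum_(D | door i0 D) #|ends D|.
  under eq_bigr => A _ do rewrite -sum1_card.
  under [RHS]eq_bigr => D _ do rewrite -sum1_card.
  rewrite !pair_big_dep/=.
  rewrite (reindex_onto (fun p : {set T + I} * (T + I) => (p.2 |: p.1, p.2))
    (fun p => (p.1 :\ p.2, p.2))) /=; last first.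
    by move=> [A x]/=; rewrite !inE => /and3P[_ xA _]; rewrite setD1K.
  apply: eq_bigl => -[D y] /=; rewrite !inE eqxx /=.
  apply/idP/idP => [/andP[/andP[dA dD] /eqP[E]]|/and3P[dD yD ->]].
    by rewrite E in dD; rewrite dD dA andbT -E !inE eqxx.
  by rewrite !setU1K// dD !eqxx.
have odd_ends : odd (\sum_(D | door i0 D) #|ends D|).
  have outer : door i0 (inr @: [set~ i0]).
    rewrite /door card_imset; last by move=> ? ? [].
    rewrite cardsC1 -imset_comp prednK; last by apply/card_gt0P; exists i0.
    by rewrite eqxx /=; apply/eqP; rewrite -[RHS]imset_id; apply: eq_imset.
  rewrite (bigD1 (inr @: [set~ i0]))//= outer_door_one_extension oddD /=.
  rewrite (big_morph odd oddD (erefl : odd 0 = false)) big1//.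
  by move=> D /andP[dD Dout]; apply/negbTE/(inner_door_even_extensions dD).
have [A dA oA] : exists2 A, dom A & odd #|rooms A|.
  apply/exists_inP; apply: contraLR odd_ends.
  rewrite negb_exists_in => /forall_inP even.
  rewrite -flip (big_morph odd oddD (erefl : odd 0 = false)) big1//.
  by move=> A /even/negbTE.
exists A => //; apply/eqP; apply: contraLR oA.
by move=> /facets_missing_color_even; apply.
Qed.

(** The combinatorial core of the fixed point theorem: a statement in the manner
    of Sperner's lemma that needs no triangulation, only finitely many orders
    on a finite set (Scarf's lemma). *)
Theorem exists_colorful_dominant : exists (S : {set T}) (C : {set I}),
  (forall i, i \in C -> exists2 x, x \in S & col x = i) /\
  (forall y, exists2 i, i \in C & forall x, x \in S -> a i y <= a i x).
Proof.
have [A /dominantP dA colA] := exists_rainbow_dominant.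
exists [set x | inl x \in A], [set i | inr i \notin A]; split.
  move=> i; rewrite inE => iA; have : i \in ext_col @: A by rewrite colA.
  move=> /imsetP[[x|j] xA /= ij]; first by exists x; rewrite ?inE.
  by rewrite ij xA in iA.
move=> y; have [i yi] := dA (inl y); exists i.
  by rewrite inE; apply/negP => /yi; rewrite /= eqxx.
by move=> x; rewrite inE => /yi; apply: ext_rank_le.
Qed.

End Colorful.

(** * Brouwer's fixed point theorem on a simplex *)

Local Open Scope classical_set_scope.
Local Open Scope ring_scope.

(** The points of the standard simplex whose barycentric coordinates are
    multiples of [1 / N], scaled by [N]. *)
Definition grid (n N : nat) :=
  {y : {ffun 'I_n.+1 -> 'I_N.+1} | (\sum_i y i == N)%N}.

Definition grid_coord n N (y : grid n N) (i : 'I_n.+1) : nat := val y i.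

Lemma grid_sum n N (y : grid n N) : (\sum_i grid_coord y i)%N = N.
Proof. by rewrite -[RHS](eqP (valP y)). Qed.

Lemma grid_of n N (e : 'I_n.+1 -> nat) : (\sum_i e i)%N = N ->
  exists y : grid n N, forall i, grid_coord y i = e i.
Proof.
move=> eN.
have e_le i : (e i < N.+1)%N by rewrite ltnS -eN (bigD1 i)//= leq_addr.
pose y := [ffun i => Ordinal (e_le i)].
have yN : (\sum_i y i == N)%N.
  by apply/eqP; rewrite -[RHS]eN; apply: eq_bigr => i _; rewrite ffunE.
by exists (exist _ y yN) => i; rewrite /grid_coord /= ffunE.
Qed.

(** Let [lo i] be the minimum on [S] of the coordinate [i] if [i] is in [C], and
    0 otherwise.  A grid point exceeding [lo] on all of [C] would not be
    dominated, so the sum of [lo] falls short of [N] by at most [n]; as every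
    point of [S] lies above [lo] and has sum [N], it is within [n] of [lo]. *)
Lemma dominant_grid_close n N (S : {set grid n N}) (C : {set 'I_n.+1}) x x' j :
  (forall y : grid n N, exists2 i, i \in C &
     forall x, x \in S -> (grid_coord y i <= grid_coord x i)%N) ->
  x \in S -> x' \in S ->
  (grid_coord x j <= (if j \in C then grid_coord x' j else 0) + n)%N.
Proof.
move=> dom xS x'S.
pose m i := grid_coord [arg min_(z < x in S) grid_coord z i]%N i.
have m_le i z : z \in S -> (m i <= grid_coord z i)%N.
  by rewrite /m; case: arg_minnP => // w _; apply.
have m_at i : exists2 z, z \in S & m i = grid_coord z i.
  by rewrite /m; case: arg_minnP => // w wS _; exists w.
have [i0 i0C _] := dom x.
pose lo i := if i \in C then m i else 0%N.
have lo_le i z : z \in S -> (lo i <= grid_coord z i)%N.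
  by rewrite /lo; case: ifP => // _; apply: m_le.
have lo_sum : (N <= \sum_i lo i + n)%N.
  rewrite leqNgt; apply/negP => lo_small.
  pose e i := (lo i + (i \in C))%N.
  have e_sum : (\sum_i e i <= N)%N.
    have : (\sum_(i < n.+1) (i \in C) <= \sum_(i < n.+1) 1)%N.
      by apply: leq_sum => i _; apply: leq_b1.
    rewrite big_split/= [X in (_ <= X)%N -> _]sum1_card card_ord => Cle.
    by apply: leq_trans (leq_add (leqnn _) Cle) _; rewrite addnS.
  (* the excess of mass is put on the coordinate i0, which belongs to C *)
  have [|y ye] := @grid_of n N (fun i => e i + (i == i0) * (N - \sum_i e i))%N.
    rewrite big_split/= -big_distrl/= [X in (_ + X * _)%N](bigD1 i0)//= eqxx.
    by rewrite [X in (true + X)%N]big1 ?mul1n ?subnKC// => i /negbTE ->.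
  have [i iC yi] := dom y.
  have [z zS mz] := m_at i.
  have := yi z zS; rewrite ye /e /lo iC -mz; lia.
apply: (@leq_trans (lo j + n)); last first.
  by rewrite leq_add2r /lo; case: ifP => // _; apply: m_le.
rewrite -(leq_add2r (\sum_(i < n.+1 | i != j) grid_coord x i)).
have xN : (\sum_i grid_coord x i = N)%N := grid_sum x.
rewrite (bigD1 j)//= in xN; rewrite xN.
apply: leq_trans lo_sum _; rewrite (bigD1 j)//= addnAC leq_add2l.
by apply: leq_sum => i _; apply: lo_le.
Qed.

Definition simplex {R : realType} {n : nat} : set 'rV[R]_n.+1 :=
  [set x | (forall i, 0 <= x 0 i) /\ \sum_i x 0 i = 1].

(** Color a grid point by a coordinate that [f] does not decrease; one exists as
    the sums of coordinates agree.  For a dominant set [S] that shows all the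
    colors in [C], each coordinate in [C] is not decreased at some point of
    [S], and those outside [C] are almost 0 on [S]. *)
Lemma approx_fixed_point (R : realType) n (f : 'rV[R]_n.+1 -> 'rV[R]_n.+1) N :
  (forall x, simplex x -> simplex (f x)) -> (0 < N)%N ->
  exists2 x, simplex x & forall i,
    exists z, [/\ simplex z, forall j, `|z 0 j - x 0 j| <= n%:R / N%:R &
      z 0 i <= f z 0 i \/ x 0 i <= n%:R / N%:R].
Proof.
move=> fS N0.
have N0' : 0 < N%:R :> R by rewrite ltr0n.
pose pt (y : grid n N) : 'rV[R]_n.+1 := \row_i ((grid_coord y i)%:R / N%:R).
have ptS y : simplex (pt y).
  split=> [i|]; first by rewrite mxE divr_ge0.
  under eq_bigr => i _ do rewrite mxE.
  by rewrite -mulr_suml -natr_sum grid_sum divff// gt_eqF.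
have /choice[col colP] : forall y, exists i, pt y 0 i <= f (pt y) 0 i.
  move=> y; apply: contrapT => /forallNP h.
  have [_ s1] := ptS y; have [_ s2] := fS _ (ptS y).
  have : \sum_i f (pt y) 0 i < \sum_i pt y 0 i.
    apply: ltr_sum; first by apply/hasP; exists ord0; rewrite ?mem_index_enum.
    by move=> i _; rewrite ltNge; apply/negP/h.
  by rewrite s1 s2 ltxx.
have [y0 _] : exists y : grid n N,
    forall i, grid_coord y i = ((i == ord0) * N)%N.
  apply: grid_of; rewrite (bigD1 ord0)//= big1 ?addn0 ?mul1n//.
  by move=> i /negbTE ->.
have [S [C [Scol Sdom]]] :=
  exists_colorful_dominant (fun i y => grid_coord y i) col y0.
have [i0 i0C _] := Sdom y0; have [x xS _] := Scol i0 i0C.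
exists (pt x) => // i; have [iC|iC] := boolP (i \in C); last first.
  exists (pt x); split=> //; first by move=> j; rewrite subrr normr0 divr_ge0.
  right; rewrite mxE ler_pM2r ?invr_gt0// ler_nat.
  by have := dominant_grid_close i Sdom xS xS; rewrite (negbTE iC).
have [z zS zi] := Scol i iC.
exists (pt z); split=> //; last by left; rewrite -zi.
have close u v j : u \in S -> v \in S ->
    (grid_coord u j <= grid_coord v j + n)%N.
  move=> uS vS; apply: leq_trans (dominant_grid_close j Sdom uS vS) _.
  by case: ifP => _; lia.
move=> j; rewrite !mxE -mulrBl normrM (gtr0_norm (x := N%:R^-1)) ?invr_gt0//.
by rewrite ler_pM2r ?invr_gt0// ler_distl lerBlDr -!natrD !ler_nat !close.
Qed.

Lemma coord_sum_continuous (R : realType) n :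
  continuous (fun v : 'rV[R]_n => \sum_i v 0 i).
Proof.
apply: continuous_big => [|i _]; first exact: add_continuous.
exact: coord_continuous.
Qed.

Lemma simplex_compact (R : realType) n : compact (@simplex R n).
Proof.
apply: (@subclosed_compact _ _
  [set v : 'rV[R]_n.+1 | forall i, v ord0 i \in `[0, 1]]).
- have -> : @simplex R n = \bigcap_i [set v : 'rV[R]_n.+1 | 0 <= v 0 i] `&`
      [set v : 'rV[R]_n.+1 | \sum_i v 0 i = 1].
    apply/seteqP; split=> v [] v0 v1; split=> // i; last exact: v0.
    by move=> _; exact: v0.
  apply: closedI; first apply: closed_bigI => i _.
    apply: (@preimage_closed _ _ (fun v : 'rV[R]_n.+1 => v 0 i)
      [set x | 0 <= x]).
      by move=> v _; apply: coord_continuous.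
    exact: closed_ge.
  apply: (@preimage_closed _ _ (fun v : 'rV[R]_n.+1 => \sum_i v 0 i)
    [set x | x = 1]); first by move=> v _; exact: coord_sum_continuous.
  exact: closed_eq.
- apply: (@rV_compact R n.+1 (fun=> `[0, 1]%classic)) => _.
  exact: segment_compact.
- move=> v [v0 v1] i /=; rewrite in_itv/= v0 -v1 (bigD1 i)//= lerDl.
  by apply: sumr_ge0.
Qed.

(** At a cluster point [p] of approximate fixed points no coordinate is
    decreased by [f]; since the coordinates of [p] and [f p] both add up to 1,
    they are equal. *)
Theorem brouwer_simplex (R : realType) n (f : 'rV[R]_n.+1 -> 'rV[R]_n.+1) :
  (forall x, simplex x -> simplex (f x)) -> {within simplex, continuous f} ->
  exists2 x, simplex x & f x = x.
Proof.
move=> fS /subspace_continuousP fcont.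
have /choice[u uP] : forall N, exists x : 'rV[R]_n.+1, simplex x /\ forall i,
    exists z, [/\ simplex z, forall j, `|z 0 j - x 0 j| <= n%:R / N.+1%:R &
      z 0 i <= f z 0 i \/ x 0 i <= n%:R / N.+1%:R].
  by move=> N; have [x xS xP] := approx_fixed_point fS (ltn0Sn N); exists x.
have [p [pS pu]] : exists p, simplex p /\ cluster (u @ \oo) p.
  have [|p h] := @simplex_compact R n (u @ \oo) _; last by exists p.
    by exists 0%N => // N _; have [] := uP N.
have pf i : p 0 i <= f p 0 i.
  rewrite leNgt; apply/negP => fp.
  have [fp0 _] := fS _ pS.
  pose d := (p 0 i - f p 0 i) / 3.
  have pd : p 0 i - f p 0 i = 3 * d by rewrite /d; lra.
  have {fp} d0 : 0 < d by lra.
  clearbody d.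
  have [e [e0 ed fe]] : exists e, [/\ 0 < e, e <= d &
      forall y, simplex y -> ball p e y -> `|f p 0 i - f y 0 i| < d].
    have /(_ _ (nbhsx_ballx _ _ d0)) := fcont p pS.
    move=> /nbhs_ballP[e /= e0 fe].
    exists (Num.min e d); split.
    - by rewrite lt_min e0.
    - by rewrite ge_min lexx orbT.
    - move=> y yS py.
      have pye : ball p e y by apply: le_ball py; rewrite ge_min lexx.
      by have [_ h] := fe y pye yS; apply: h.
  pose N0 := Num.truncn (n%:R / (e / 2)).
  have hN0 N : (N0 <= N)%N -> n%:R / N.+1%:R < e / 2.
    move=> NN0; rewrite ltr_pdivrMr// -ltr_pdivrMl ?divr_gt0// mulrC.
    by apply: (lt_le_trans (truncnS_gt _)); rewrite ler_nat.
  have e20 : 0 < e / 2 by rewrite divr_gt0.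
  have late : (u @ \oo) [set u N | N in [set N | (N0 <= N)%N]].
    by exists N0 => // N /= NN0; exists N.
  have [_ [[N NN0 <-] [_ pN]]] := pu _ _ late (nbhsx_ballx p _ e20).
  have [uS /(_ i)[z [zS zu zi]]] := uP N.
  have {}hN0 := hN0 N NN0.
  have pNi : `|p 0 i - u N 0 i| < e / 2 by apply: pN.
  case: zi => [zi|ui].
    have pz : ball p e z.
      split=> // a j; rewrite (ord1 a) /ball/= (splitr e).
      rewrite -(subrKA (u N 0 j)) (le_lt_trans (ler_normD _ _))// ltrD//.
        exact: pN.
      by rewrite distrC (le_lt_trans (zu j)).
    have pzi : `|p 0 i - z 0 i| < e by apply: pz.2.
    have := fe z zS pz.
    move: pzi; rewrite !ltr_norml => /andP[? ?] /andP[? ?]; lra.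
  move: pNi; rewrite ltr_norml => /andP[? ?].
  have := fp0 i; have := le_lt_trans ui hN0; lra.
exists p => //; apply/rowP => i; apply/eqP.
have [_ s1] := pS; have [_ s2] := fS _ pS.
have : \sum_i (f p 0 i - p 0 i) = 0 by rewrite sumrB s1 s2 subrr.
move=> /psumr_eq0P h; rewrite -subr_eq0; apply/eqP/h => // j _.
by rewrite subr_ge0.
Qed.

(** * Hyperplanes as kernels of linear forms *)

Lemma linear_rV_continuous (R : realType) n (V : normedModType R)
  (f : {linear 'rV[R]_n -> V}) : continuous f.
Proof.
have -> : (f : 'rV[R]_n -> V) = fun x => \sum_i x 0 i *: f 'e_i.
  apply/funext => x; rewrite {1}(row_sum_delta x) linear_sum.
  by apply: eq_bigr => i _; rewrite linearZ.
apply: continuous_big => [|i _ x]; first exact: add_continuous.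
apply: (@cvgZr_tmp _ _ _ (nbhs x)); exact: (@coord_continuous R _ _ 0 i).
Qed.

(** The linear form reads off the coordinate along a vector outside [H] in the
    direct sum of its line with [H]. *)
Lemma hyperplane_kernel (R : realType) n (H : {vspace 'rV[R]_n.+1}) :
  \dim H = n -> exists lam : {linear 'rV[R]_n.+1 -> R^o},
    (forall u, (u \in H) = (lam u == 0)) /\ exists w, lam w != 0.
Proof.
move=> dimH.
have dimV : \dim {:'rV[R]_n.+1} = n.+1.
  by rewrite dimvf; exact: etrans (dim_matrix _ _ _) (mul1n _).
have [v0 v0H] : exists v0, v0 \notin H.
  apply: contrapT => /forallNP h; have : (fullv <= H)%VS.
    by apply/subvP => v _; have /negP := h v; rewrite negbK.
  by move=> /dimvS; rewrite dimV dimH ltnn.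
have v00 : v0 != 0 by apply: contraNneq v0H => ->; rewrite mem0v.
have cap0 : (<[v0]> :&: H = 0)%VS.
  apply/eqP; rewrite -subv0; apply/subvP => v.
  rewrite memv_cap => /andP[/vlineP[k ->]].
  have [->|k0] := eqVneq k 0; first by rewrite scale0r !mem0v.
  by move=> kv; have := memvZ k^-1 kv; rewrite scalerK// (negPf v0H).
have sumV : (<[v0]> + H)%VS = fullv.
  apply/eqP; rewrite eqEdim subvf dimV dimv_disjoint_sum// dim_vline v00 dimH.
  by rewrite add1n leqnn.
pose lam : {linear 'rV[R]_n.+1 -> R^o} :=
  coord [tuple v0] ord0 \o daddv_pi <[v0]> H.
have lamE u : u = lam u *: v0 + daddv_pi H <[v0]> u.
  rewrite -[LHS](daddv_pi_add cap0) ?sumV ?memvf//; congr (_ + _).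
  have vspan : daddv_pi <[v0]> H u \in <<[tuple v0]>>%VS.
    by rewrite span_seq1 memv_pi.
  by rewrite {1}(coord_span vspan) big_ord1.
have lamP u : (u \in H) = (lam u == 0).
  rewrite [in LHS](lamE u) rpredDr ?memv_pi//.
  have [->|l0] := eqVneq (lam u) 0; first by rewrite scale0r mem0v.
  apply/negbTE; apply: contra v0H => lv.
  by have := memvZ (lam u)^-1 lv; rewrite scalerK.
by exists lam; split=> //; exists v0; rewrite -lamP.
Qed.

Lemma exists_basis_neq0 (R : realType) n (lam : {linear 'rV[R]_n.+1 -> R^o}) w :
  lam w != 0 -> exists k, lam 'e_k != 0.
Proof.
move=> lw; apply/existsP; apply: contraR lw.
rewrite negb_exists => /forallP h; rewrite (row_sum_delta w) linear_sum big1//.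
by move=> i _; rewrite linearZ/= (eqP (negPn (h i))) scaler0.
Qed.

(** The form vanishes on the difference quotients of a curve in the hyperplane,
    hence on its velocity; conversely, a segment of the line in the direction
    [v] stays in the open set [U]. *)
Lemma tangent_space_hyperplane (R : realType) n
    (lam : {linear 'rV[R]_n.+1 -> R^o}) (a p : 'rV[R]_n.+1)
    (U : set 'rV[R]_n.+1) :
  open U -> lam (p - a) = 0 -> U p ->
  tangent_space ([set x | lam (x - a) = 0] `&` U) p = [set v | lam v = 0].
Proof.
have lamZ c u : lam (c *: u) = c * lam u by exact: linearZ.
move=> oU lpa Up; apply/seteqP; split=> v /=.
  move=> [g [g0 gM [gder gv]]].
  have quot := cvg_toP gder gv.
  have lam_quot := cvg_comp _ lam quot (@linear_rV_continuous _ _ _ lam v).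
  apply: (closed_cvg [set 0 : R^o] _ _ _ lam_quot); first exact: closed_eq.
  have {}gM := @cvg_within _ (nbhs (0 : R)) _ [set t | t != 0] _ gM.
  near=> t; have [gt _] : ([set x | lam (x - a) = 0] `&` U) (g t).
    by near: t; exact: gM.
  rewrite /= lamZ addr0 [t *: 1]mulr1 g0.
  rewrite -(subrKA a) linearD gt -opprB linearN lpa.
  by rewrite oppr0 addr0 mulr0.
move=> lv; exists (fun t => p + t *: v).
have gder : is_derive (0 : R) (1 : R) (fun t : R => p + t *: v) v.
  have quot : h^-1 *: (((fun t : R => p + t *: v) \o shift 0) (h *: 1) -
      (p + 0 *: v)) @[h --> (0 : R)^'] --> v.
    apply: cvg_near_cst; near=> h.
    rewrite /= addr0 scale0r addr0 addrC addKr [h *: 1]mulr1 scalerK//.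
    by near: h; exact: nbhs_dnbhs_neq.
  by apply: DeriveDef; [apply: cvgP quot | exact: cvg_lim quot].
split=> //; first by rewrite scale0r addr0.
have gU : \forall t \near (0 : R), U (p + t *: v).
  have : (p + t *: v) @[t --> (0 : R)] --> p + 0 *: v.
    apply: (@cvgD _ _ _ (nbhs (0 : R))); first exact: cvg_cst.
    by apply: (@cvgZr_tmp _ _ _ (nbhs (0 : R))); exact: cvg_id.
  by rewrite scale0r addr0; apply; exact: open_nbhs_nbhs.
apply: filterS gU => t gU; split=> //.
by rewrite /= addrAC linearD lamZ lv lpa mulr0 addr0.
Unshelve. all: by end_near.
Qed.

(** * A local fixed point theorem in a hyperplane *)

Section LocalFixedPoint.
Variables (R : realType) (n : nat) (lam : {linear 'rV[R]_n.+1 -> R^o}).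
Variable k : 'I_n.+1.
Hypothesis lamk : lam 'e_k != 0.
Implicit Types u x y p : 'rV[R]_n.+1.

(* The maps to_ker and to_sum0 project along the same basis vector onto the
   kernel of lam and onto the vectors of coordinate sum 0; restricted to the
   image of the other, each is inverse to the other. *)
Let barycenter : 'rV[R]_n.+1 := const_mx (n.+1%:R^-1).
Let to_ker u : 'rV[R]_n.+1 := u - (lam u / lam 'e_k) *: 'e_k.
Let to_sum0 u : 'rV[R]_n.+1 := u - (\sum_i u 0 i) *: 'e_k.

Let lamZ c u : lam (c *: u) = c * lam u. Proof. exact: linearZ. Qed.
Let lamB u v : lam (u - v) = lam u - lam v. Proof. exact: linearB. Qed.

Lemma lam_to_ker u : lam (to_ker u) = 0.
Proof. by rewrite lamB lamZ divfK// subrr. Qed.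

Lemma sum_to_sum0 u : \sum_i to_sum0 u 0 i = 0.
Proof.
under eq_bigr => i _ do rewrite !mxE eqxx/=.
rewrite big_split/= sumrN -mulr_sumr [X in _ * X](bigD1 k)//= eqxx.
rewrite [X in 1 + X]big1 ?addr0 ?mulr1 ?subrr// => i /negbTE.
by rewrite eq_sym => ->.
Qed.

Lemma to_sum0K u (e : R) : lam u = 0 -> e != 0 ->
  e *: to_ker (e^-1 *: to_sum0 u) = u.
Proof.
move=> u0 e0.
suff -> : to_ker (e^-1 *: to_sum0 u) = e^-1 *: u by rewrite scalerKV.
rewrite /to_ker lamZ {2}/to_sum0 lamB u0 lamZ sub0r -mulNr mulrA mulfK//.
by rewrite -scalerA -scalerBr /to_sum0 scaleNr opprK subrK.
Qed.

Lemma to_ker_continuous : continuous to_ker.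
Proof.
move=> u; apply: (@cvgB _ _ _ (nbhs u)); first exact: cvg_id.
apply: (@cvgZr_tmp _ _ _ (nbhs u)).
by apply: (@cvgMr_tmp _ _ (nbhs u)); exact: linear_rV_continuous.
Qed.

Lemma to_sum0_continuous : continuous to_sum0.
Proof.
move=> u; apply: (@cvgB _ _ _ (nbhs u)); first exact: cvg_id.
apply: (@cvgZr_tmp _ _ _ (nbhs u)); exact: coord_sum_continuous.
Qed.

(** Brouwer's theorem applies in a small simplex of the hyperplane around [p0]:
    an affine chart [psi] maps the standard simplex into the ball of radius [d]
    and its barycenter to [p0], and a continuous right inverse [chi] of [psi]
    over the hyperplane maps the ball of radius [e] into the standard simplex.
    A fixed point of [G] is the image under [psi] of one of the composition of
    [psi], [G] and [chi]. *)
Theorem local_fixed_point p0 (d : R) : 0 < d -> exists2 e, 0 < e &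
  forall G : 'rV[R]_n.+1 -> 'rV[R]_n.+1,
    let D := [set p | lam (p - p0) = 0 /\ ball p0 d p] in
    {within D, continuous G} ->
    (forall p, D p -> lam (G p - p0) = 0 /\ ball p0 e (G p)) ->
    exists2 p, D p & G p = p.
Proof.
move=> d0.
pose shape x := to_ker (x - barycenter).
have shape_cont : continuous shape.
  move=> x; apply: continuous_comp; last exact: to_ker_continuous.
  by apply: (@cvgB _ _ _ (nbhs x)); [exact: cvg_id|exact: cvg_cst].
have [K K0 shapeK] : exists2 K, 0 < K & forall x, simplex x -> `|shape x| <= K.
  have : bounded_set (shape @` simplex).
    apply/compact_bounded/continuous_compact; last exact: simplex_compact.
    exact: continuous_subspaceT.
  move=> [K [Kreal Kb]]; exists (`|K| + 1); first by rewrite ltr_wpDl.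
  move=> x xS; apply: (Kb (`|K| + 1)); last by exists x.
  by rewrite (le_lt_trans (ler_norm _))// ltrDl.
(* any factor below d / K keeps the simplex inside the ball of radius d *)
pose r := d / (K + K).
have r0 : 0 < r by rewrite divr_gt0// addr_gt0.
pose psi x := p0 + r *: shape x.
have psi_cont : continuous psi.
  move=> x; apply: (@cvgD _ _ _ (nbhs x)); first exact: cvg_cst.
  by apply: (@cvgZl_tmp _ _ _ (nbhs x)); exact: shape_cont.
have lam_psi x : lam (psi x - p0) = 0.
  by rewrite addrC addKr lamZ lam_to_ker mulr0.
have psi_ball x : simplex x -> ball p0 d (psi x).
  move=> xS; rewrite -ball_normE /ball_/= opprD addNKr normrN normrZ.
  rewrite gtr0_norm//.
  rewrite (@le_lt_trans _ _ (r * K))// ?ler_pM2l ?shapeK//.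
  have -> : r * K = d / 2 by rewrite /r; field; rewrite ?gt_eqF ?addr_gt0//.
  by rewrite ltr_pdivrMr// ltr_pMr// ltr1n.
have n0 : 0 < n.+1%:R^-1 :> R by rewrite invr_gt0.
have rn0 : 0 < r * n.+1%:R^-1 by rewrite mulr_gt0.
have to_sum00 : to_sum0 0 = 0.
  by rewrite /to_sum0 big1 ?scale0r ?subr0// => i _; rewrite mxE.
(* coordinates that differ from the barycenter by less than n.+1%:R^-1 remain
   nonnegative *)
have [e e0 small] : exists2 e, 0 < e &
    forall y, ball p0 e y -> forall i, `|to_sum0 (y - p0) 0 i| < r * n.+1%:R^-1.
  have /nbhs_ballP[e e0 he] := @to_sum0_continuous 0 _ (nbhsx_ballx _ _ rn0).
  exists e => // y py i; have [] := he (y - p0).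
    by rewrite -ball_normE /ball_/= sub0r opprB; rewrite -ball_normE in py.
  by move=> _ /(_ 0 i); rewrite /ball/= to_sum00 mxE sub0r normrN.
pose chi y := barycenter + r^-1 *: to_sum0 (y - p0).
have chiE y i : chi y 0 i = n.+1%:R^-1 + r^-1 * to_sum0 (y - p0) 0 i.
  by rewrite [LHS]mxE [X in X + _]mxE [X in _ + X]mxE.
have chi_cont : continuous chi.
  move=> y; apply: (@cvgD _ _ _ (nbhs y)); first exact: cvg_cst.
  apply: (@cvgZl_tmp _ _ _ (nbhs y)).
  apply: (@continuous_comp _ _ _ (fun y => y - p0) to_sum0);
    last exact: to_sum0_continuous.
  by apply: (@cvgB _ _ _ (nbhs y)); [exact: cvg_id|exact: cvg_cst].
have chiS y : ball p0 e y -> simplex (chi y).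
  move=> py; split=> [i|].
    have := small _ py i; rewrite ltr_norml => /andP[+ _].
    rewrite chiE => rt.
    rewrite -{1}[n.+1%:R^-1](mulKf (lt0r_neq0 r0)) -mulrDr mulr_ge0 ?invr_ge0//.
      exact: ltW.
    by rewrite addrC -lerBlDr sub0r ltW.
  under eq_bigr => i _ do rewrite chiE.
  rewrite big_split/= -mulr_sumr sum_to_sum0 mulr0 addr0.
  by rewrite sumr_const card_ord -[LHS]mulr_natr mulVf.
have chiK y : lam (y - p0) = 0 -> psi (chi y) = y.
  move=> y0; rewrite /psi /shape /chi (addrC barycenter) addrK.
  rewrite to_sum0K ?gt_eqF//.
  by rewrite addrC subrK.
exists e => // G D Gcont Gball.
have psiD x : simplex x -> D (psi x) by move=> xS; split; [|exact: psi_ball].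
have [x xS fx] : exists2 x, simplex x & chi (G (psi x)) = x.
  apply: brouwer_simplex => [x xS|].
    by apply/chiS; have [] := Gball _ (psiD x xS).
  apply/subspace_continuousP => x xS.
  move/subspace_continuousP : Gcont => /(_ _ (psiD x xS)) Gx.
  apply: (@cvg_comp _ _ _ (G \o psi) chi _ (nbhs (G (psi x))));
    last exact: chi_cont.
  apply: (@cvg_comp _ _ _ psi G _ (within D (nbhs (psi x))));
    last exact: Gx.
  move=> W WD.
  apply: (@filterS _ (nbhs x) _ _ _ _ (psi_cont x _ WD)) => z /= h zS.
  exact: h (psiD z zS).
exists (psi x); first exact: psiD.
by rewrite -{2}fx chiK//; have [] := Gball _ (psiD x xS).
Qed.

End LocalFixedPoint.

(** * Lines transverse to a hyperplane *)

Section Projective.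
Variables (R : realType) (n : nat) (lam : {linear 'rV[R]_n.+1 -> R^o}).
Implicit Types (l : projective R n) (u v : 'rV[R]_n.+1).

Let lamZ c u : lam (c *: u) = c * lam u. Proof. exact: linearZ. Qed.

Definition transverse l := lam (vpick l) != 0.
Definition normalized u := (lam u)^-1 *: u.
(** A line transverse to the kernel of [lam] meets the affine hyperplane
    [lam = 1] in exactly one point. *)
Definition unit_point l := normalized (vpick l).

Lemma lam_unit_point l : transverse l -> lam (unit_point l) = 1.
Proof. by move=> tl; rewrite lamZ mulVf. Qed.

Lemma unit_point_mem l : unit_point l \in line_of l.
Proof. by apply/memvZ/memv_pick. Qed.

Lemma line_vpick l : line_of l = <[vpick l]>%VS.
Proof.
have l0 : line_of l != 0%VS by rewrite -dimv_eq0 (eqP (line_ofP l)).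
apply/esym/eqP; rewrite eqEdim -memvE memv_pick dim_vline vpick0 l0.
by rewrite (eqP (line_ofP l)).
Qed.

Lemma line_point l u : u \in line_of l -> lam u != 0 ->
  transverse l /\ normalized u = unit_point l.
Proof.
rewrite line_vpick => /vlineP[c ->]; rewrite lamZ mulf_eq0 negb_or.
move=> /andP[c0 tl]; split=> //.
by rewrite /normalized scalerA lamZ invfM mulrAC mulVf// mul1r.
Qed.

Lemma normalized_continuous u : lam u != 0 -> {for u, continuous normalized}.
Proof.
move=> lu; apply: (@cvgZ _ _ _ (nbhs u)); last exact: cvg_id.
by apply: (@cvgV _ _ (nbhs u)) => //; exact: linear_rV_continuous.
Qed.

(** Transversality is an open condition, and [unit_point] is continuous where
    it holds: in the quotient topology both follow from the continuity of
    [normalized] on the vectors where [lam] is nonzero. *)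
Lemma unit_point_nbhs l (W : set 'rV[R]_n.+1) : transverse l ->
  nbhs (unit_point l) W -> nbhs l [set m | transverse m /\ W (unit_point m)].
Proof.
move=> tl; rewrite {1}nbhsE => -[W' [oW' W'l] W'W].
have : nbhs l [set m | transverse m /\ W' (unit_point m)].
  apply: open_nbhs_nbhs; split=> //.
  suff : open [set v : 'rV[R]_n.+1 | lam v != 0 /\ W' (normalized v)].
    congr (open _); apply/seteqP; split=> v /=.
      move=> [lv W'v].
      have v0 : v != 0 by apply: contraNneq lv => ->; rewrite linear0.
      have dv : \dim <[v]>%VS == 1%N by rewrite dim_vline v0.
      exists (Projective dv) => //.
      by have [tv <-] := @line_point (Projective dv) v (memv_line v) lv.
    move=> [m [tm W'm] vm].
    have vm' : v \in line_of m by rewrite -vm memv_line.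
    have lv : lam v != 0.
      apply: contra_neq tm => lv0; have := memv_pick m; rewrite -vm.
      by move=> /vlineP[c ->]; rewrite lamZ lv0 mulr0.
    by have [_ ->] := line_point vm' lv.
  rewrite openE => v [lv W'v].
  have h1 : nbhs v [set w | lam w != 0].
    have : nbhs (lam v) [set x : R^o | x != 0].
      by apply: open_nbhs_nbhs; split=> //; exact: open_neq.
    exact: linear_rV_continuous.
  have h2 : nbhs v [set w | W' (normalized w)].
    apply: (normalized_continuous lv).
    exact: open_nbhs_nbhs.
  exact: filterI h1 h2.
by apply: filterS => m [tm W'm]; split=> //; exact: W'W.
Qed.

End Projective.

(** * Interior points of the union of the lines *)

(** A hyperplane is left at once along a vector on which the form is nonzero. *)
Lemma kernel_interior (R : realType) n (lam : {linear 'rV[R]_n.+1 -> R^o})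
    (a w : 'rV[R]_n.+1) : lam w != 0 ->
  interior [set x | lam (x - a) = 0] = set0.
Proof.
move=> lw; rewrite -subset0 => q qi.
have lamZ c u : lam (c *: u) = c * lam u by exact: linearZ.
have line : (q + t *: w) @[t --> (0 : R)] --> q + 0 *: w.
  apply: (@cvgD _ _ _ (nbhs (0 : R))); first exact: cvg_cst.
  by apply: (@cvgZr_tmp _ _ _ (nbhs (0 : R))); exact: cvg_id.
rewrite scale0r addr0 in line.
have {}line : \forall t \near (0 : R)^', lam (q + t *: w - a) = 0.
  exact: (@cvg_within _ (nbhs (0 : R)) _ _ _ (line _ qi)).
have [t [tq t0]] := filter_ex (filterI line (nbhs_dnbhs_neq (0 : R))).
have /= q0 := nbhs_singleton qi.
move: tq; rewrite addrAC linearD q0 add0r lamZ => /eqP.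
by rewrite mulf_eq0 (negPf lw) (negPf t0).
Qed.

(** The line through [p] directed by [phi p] contains [q] as soon as [p] is a
    fixed point of [G p = q - lam (q - p0) *: s p], where [s p] is the unit
    point of [phi p].  This map takes values in the hyperplane because
    [lam (s p) = 1], and close to [p0] when [q] is close to [p0], as [s] is
    locally bounded. *)
Lemma transverse_interior (R : realType) n
    (lam : {linear 'rV[R]_n.+1 -> R^o}) (a p0 : 'rV[R]_n.+1)
    (U : set 'rV[R]_n.+1) (phi : 'rV[R]_n.+1 -> projective R n) :
  let M : set 'rV[R]_n.+1 := [set x | lam (x - a) = 0] `&` U in
  open U -> {within M, continuous phi} -> M p0 -> transverse lam (phi p0) ->
  interior (codiagonal @` line_bundle M phi) p0.
Proof.
move=> M oU /subspace_continuousP phic Mp0 tp0.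
have lamZ c u : lam (c *: u) = c * lam u by exact: linearZ.
have lamB u v : lam (u - v) = lam u - lam v by exact: linearB.
pose s p := unit_point lam (phi p).
have [k lamk] := exists_basis_neq0 tp0.
have [d d0 dP] : exists2 d, 0 < d & forall p, ball p0 d p -> lam (p - p0) = 0 ->
    [/\ M p, transverse lam (phi p) & `|s p| <= `|s p0| + 1].
  have near_s := unit_point_nbhs tp0 (nbhsx_ballx (s p0) 1 ltr01).
  have near_M : nbhs p0
      [set p | M p -> transverse lam (phi p) /\ ball (s p0) 1 (s p)].
    exact: phic p0 Mp0 _ near_s.
  have near_U : nbhs p0 U by apply: open_nbhs_nbhs; split=> //; exact: Mp0.2.
  have := @filterI _ _ (nbhs_filter p0) _ _ near_M near_U.
  move=> /nbhs_ballP[d d0 dP].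
  exists d => // p /dP[/= h Up] lp.
  have Mp : M p.
    split=> //=; rewrite -(subrKA p0) linearD lp add0r; exact: Mp0.1.
  have [tp sp] := h Mp; split=> //.
  move: sp; rewrite -ball_normE /ball_/= => /ltW sp.
  rewrite -lerBlDl; apply: le_trans sp; rewrite distrC; exact: lerB_dist.
have [e e0 fixed] := local_fixed_point lamk p0 d0.
have near_q : \forall q \near p0,
    `|q - p0| + `|lam (q - p0)| * (`|s p0| + 1) < e.
  have c : continuous (fun q : 'rV[R]_n.+1 =>
      `|q - p0| + `|lam (q - p0)| * (`|s p0| + 1)).
    move=> q.
    have qc : (x - p0) @[x --> q] --> q - p0.
      by apply: (@cvgB _ _ _ (nbhs q)); [exact: cvg_id|exact: cvg_cst].
    apply: (@cvgD _ _ _ (nbhs q)); first exact: (@cvg_norm _ _ _ (nbhs q)).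
    apply: (@cvgMr_tmp _ _ (nbhs q)).
    apply: (@cvg_norm _ _ _ (nbhs q)).
    exact: cvg_comp qc (@linear_rV_continuous _ _ _ lam (q - p0)).
  apply: (c p0 [set x | x < e]); apply: open_nbhs_nbhs; split.
    exact: open_lt.
  by rewrite /= subrr linear0 !normr0 mul0r addr0.
apply: filterS near_q => q qe.
pose G p := q - lam (q - p0) *: s p.
have [||p [lp pd] Gp] := fixed G.
- apply/subspace_continuousP => p [lp pd].
  have [Mp tp _] := dP p pd lp.
  apply: (@cvgB _ _ _ (within _ (nbhs p))); first exact: cvg_cst.
  apply: (@cvgZl_tmp _ _ _ (within _ (nbhs p))).
  move=> W Ws; have := phic p Mp _ (unit_point_nbhs tp Ws).
  apply: (@filterS _ (nbhs p)) => z h [lz zd].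
  have [Mz _ _] := dP z zd lz; exact: (h Mz).2.
- move=> p [lp pd]; have [Mp tp sp] := dP p pd lp.
  split; first by rewrite /G addrAC lamB lamZ lam_unit_point// mulr1 subrr.
  rewrite -ball_normE /ball_/= distrC /G addrAC.
  apply: le_lt_trans qe; apply: le_trans (ler_normB _ _) _.
  by rewrite lerD2l normrZ ler_wpM2l.
have [Mp tp _] := dP p pd lp.
exists (p, lam (q - p0) *: s p); first split=> //=.
  by apply: memvZ; exact: unit_point_mem.
by rewrite /codiagonal/= -{1}Gp /G subrK.
Qed.

(** * Tangency and interior *)

Theorem theorem5p2p1 (R : realType) (n : nat) (M : set 'rV[R]_n.+1)
    (phi : 'rV[R]_n.+1 -> projective R n) :
  linear_hypersurface M ->
  {within M, continuous phi} ->
  (interior (codiagonal @` line_bundle M phi) !=set0 <->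
   ~ line_bundle_tangent M phi).
Proof.
move=> [_ _ [A [U [[a [H [dimH ->]]] oU ->]]]].
have [lam [lamP [w lw]]] := hyperplane_kernel dimH.
have -> : [set x | x - a \in H] = [set x | lam (x - a) = 0].
  by apply/seteqP; split=> x /=; rewrite lamP => /eqP.
set M' := _ `&` U => phic.
have tangentE p : M' p -> tangent_space M' p = [set v | lam v = 0].
  by move=> [lp Up]; apply: tangent_space_hyperplane.
split=> [[q qi] tangent|].
  have : interior [set x | lam (x - a) = 0] q.
    apply: filterS qi => _ [[p u] [/= Mp pu] <-].
    have := tangent p Mp u pu; rewrite tangentE//= => lu.
    by rewrite /codiagonal/= addrAC linearD lu addr0; exact: Mp.1.
  by rewrite (kernel_interior a lw).
move=> /existsNP[p0 /not_implyP[Mp0 /existsNP[u /not_implyP[/= up]]]].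
rewrite tangentE//= => /eqP lu; exists p0; apply: transverse_interior => //.
by have [] := line_point up lu.
Qed.
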